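(* Both $\mathcal H(P;t)$ and $\mathrm{SE}(P;z)$ satisfy the valuation property on convex lattice polytopes: if $P, Q \subset \mathbb{R}^n$ are convex lattice polytopes such that $P \cup Q$ and $P \cap Q$ are also convex lattice polytopes, then \[ \mathcal H(P\cup Q;t) = \mathcal H(P;t) + \mathcal H(Q;t) - \mathcal H(P\cap Q;t) \] and \[ \mathrm{SE}(P\cup Q;z) = \mathrm{SE}(P;z) + \mathrm{SE}(Q;z) - \mathrm{SE}(P\cap Q;z). \] That is, the assignments $[P] \mapsto \mathcal H(P;t)$ and $[P] \mapsto \mathrm{SE}(P;z)$ extend to well-defined linear (additive) maps from the Grothendieck group of convex lattice polytopes in $\mathbb{R}^n$ to $\mathbb{Q}[t]$ and $\mathbb{Z}[[z]]$, respectively.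
   Context: A convex lattice polytope in $\mathbb{R}^n$ is the convex hull of a nonempty finite subset of $\mathbb{Z}^n$. The Grothendieck group of convex lattice polytopes in $\mathbb{R}^n$ is the free abelian group on symbols $[P]$, one for each convex lattice polytope $P \subset \mathbb{R}^n$, modulo the relations $[P\cup Q] + [P\cap Q] = [P] + [Q]$ for all convex lattice polytopes $P, Q$ such that $P\cup Q$ and $P\cap Q$ are convex lattice polytopes. A horizontal giganture of $P$ is a set of the form $iP + a$ with an integer $i \ge 0$ (the scale factor) and $a \in \mathbb{Z}^n$ (for $i=0$ it is the single point $a$). For an integer $t \ge 0$, $\mathcal H(P;t)$ is the number of horizontal gigantures of $P$ contained in $tP$, counted as pairs $(i,a)$ with $0 \le i \le t$, $a \in \mathbb{Z}^n$, $iP + a \subset tP$. (For $\dim P \ge 1$ this is simply the number of sets $iP+a$, $i \in \mathbb{Z}_{\ge 0}$, $a \in \mathbb{Z}^n$, contained in $tP$.) It is known that $\mathcal H(P;t)$ agrees for all integers $t\ge 0$ with a polynomial in $t$ with rational coefficients, also denoted $\mathcal H(P;t)$. Put $\mathrm{SE}(P;z) := \sum_{t=0}^\infty \mathcal H(P;t) z^t$. *)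

(* Defs.v *)
From HB Require Import structures.
From mathcomp Require Import all_boot all_order all_algebra.
From mathcomp Require Import finmap ring_quotient generic_quotient.
From mathcomp Require Import mathcomp_extra boolp classical_sets functions.
From mathcomp Require Import cardinality reals convex.
From mathcomp Require Import freeg.

Set Implicit Arguments.
Unset Strict Implicit.
Unset Printing Implicit Defensive.

Import Order.TTheory GRing.Theory Num.Theory.

Local Open Scope classical_set_scope.
Local Open Scope ring_scope.

Definition conv_hull (R : realType) (n : nat) (S : set 'rV[R]_n) :
    set 'rV[R]_n :=
  smallest (@convex_set R 'rV[R]_n) S.

Definition lattice_pt (R : realType) (n : nat) (a : 'rV[int]_n) : 'rV[R]_n :=
  map_mx intr a.
Arguments lattice_pt R {n} a.

Definition lattice_polytope (R : realType) (n : nat) (P : set 'rV[R]_n) :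
    Prop :=
  exists V : set 'rV[int]_n,
    [/\ finite_set V, V !=set0 & P = conv_hull (lattice_pt R @` V)].

Definition dilate (R : realType) (n : nat) (k : nat) (P : set 'rV[R]_n) :
    set 'rV[R]_n :=
  [set k%:R *: x | x in P].

Definition hgiganture (R : realType) (n : nat) (P : set 'rV[R]_n)
    (i : nat) (a : 'rV[int]_n) : set 'rV[R]_n :=
  [set y + lattice_pt R a | y in dilate i P].

Definition hgigantures_in (R : realType) (n : nat) (P : set 'rV[R]_n)
    (t : nat) : set (nat * 'rV[int]_n) :=
  [set ia | (ia.1 <= t)%N /\ hgiganture P ia.1 ia.2 `<=` dilate t P].

(* The horizontal gigantures of P in t P are counted as pairs (i, a), so that
   different pairs giving the same set are distinguished when P is a point.
   [fset_set] sends infinite sets to the empty finite set; for a lattice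
   polytope P, which is bounded, [hgigantures_in P t] is finite. *)
Definition Hcount (R : realType) (n : nat) (P : set 'rV[R]_n) (t : nat) : nat :=
  #|` fset_set (hgigantures_in P t)|.

(* The polynomial in Q[t] with the values Hcount P t at all natural numbers t
   (unique if it exists; the default value 0 is returned if there is none). *)
Definition Hpoly (R : realType) (n : nat) (P : set 'rV[R]_n) : {poly rat} :=
  xget 0 [set p : {poly rat} | forall t : nat, p.[t%:R] = (Hcount P t)%:R].

(* Z[[z]] as the additive group of coefficient sequences: the coefficient of
   z^t is the value at t.  Its multiplication is not needed. *)
Definition int_series : Type := nat -> int.
HB.instance Definition _ := GRing.Zmodule.copy int_series (nat -> int).

Definition SE (R : realType) (n : nat) (P : set 'rV[R]_n) : int_series :=
  fun t => (Hcount P t)%:Z.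

Section Grothendieck.
Context (R : realType) (n : nat).

Definition polytope : Type := [set P : set 'rV[R]_n | lattice_polytope P].
HB.instance Definition _ := Choice.on polytope.

Local Notation free := {freeg polytope / int}.

Definition inclexcl_relation : set free :=
  [set x | exists P Q U I : polytope,
    [/\ val U = val P `|` val Q, val I = val P `&` val Q &
        x = (<< U >> + << I >>) - (<< P >> + << Q >>)]].

(* The subgroup generated by the relations. *)
Definition inclexcl_subgroup : {pred free} :=
  fun x => `[< forall S : {pred free},
    zmod_closed S -> (forall y, inclexcl_relation y -> y \in S) -> x \in S >].

Lemma inclexcl_subgroup_zmod_closed : zmod_closed inclexcl_subgroup.
Proof.
split=> [|x y /asboolP xS /asboolP yS]; apply/asboolP => S cS relS.
  by case: cS.
by case: (cS) => _; apply; [exact: xS|exact: yS].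
Qed.

HB.instance Definition _ :=
  GRing.isZmodClosed.Build free inclexcl_subgroup
    inclexcl_subgroup_zmod_closed.

Definition polytope_group : zmodType := Quotient.quot inclexcl_subgroup.

Definition polytope_class (P : polytope) : polytope_group :=
  (\pi_(Quotient.quot inclexcl_subgroup) (<< P >> : free))%qT.

End Grothendieck.

(* Main.v *)
(* By cancellation of Minkowski summands, [i P + a] lies in [t P] iff [a] is a
   lattice point of [(t - i) P], so [Hcount P t] is the number of pairs [(i, a)]
   with [i <= t] and [a] in [(t - i) P].  Dilation commutes with unions and with
   nonempty intersections, so these sets of pairs satisfy inclusion-exclusion.

   That [Hcount P] is a polynomial is Ehrhart's theorem.  Each point of [j P] has
   a unique representation as a nonnegative combination of the vertices, with
   coefficients of sum [j], that is lexicographically largest.  Whether a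
   representation is largest depends only on its support, and the supports so
   obtained form a simplicial complex which is a cone over the first vertex.
   Splitting each coefficient into an integral and a fractional part, the latter
   in [0, 1) for the first vertex and in (0, 1] for the other vertices of the
   support, writes the representations as disjoint families indexed by finitely
   many box points.  A box point of height [h] whose face has [d] vertices,
   including the first one, contributes ['C(t + d - h, d)] to the total up to
   [t].  Since [h < d], this is a polynomial in [t] for all [t >= 0]. *)
Require Import Defs.
From HB Require Import structures.
From mathcomp Require Import all_boot all_order all_algebra.
From mathcomp Require Import boolp classical_sets functions reals.
From mathcomp Require Import finmap freeg.
From mathcomp Require Import unstable mathcomp_extra cardinality convex interval_inference.
From mathcomp Require Import topology normedtype derive.

Import numFieldNormedType.Exports.

Import Order.TTheory GRing.Theory Num.Theory.

Local Open Scope classical_set_scope.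
Local Open Scope ring_scope.

(** * Gigantures as lattice points of dilates *)

Definition simplex {R : realType} (m : nat) (t : R) : set 'rV[R]_m :=
  [set l | (forall i, 0 <= l 0 i) /\ \sum_i l 0 i = t].

(** [convex_set] speaks of two points only, so the first point is split off and the others are
    rescaled by their total weight [s]; if [s = 0], the first point carries everything. *)
Lemma convex_set_sum {R : realType} {E : lmodType R} (A : set E) m
    (w : 'I_m.+1 -> E) (l : 'I_m.+1 -> R) :
  convex_set A -> (forall i, w i \in A) -> (forall i, 0 <= l i) ->
  \sum_i l i = 1 -> \sum_i l i *: w i \in A.
Proof.
move=> cA; elim: m w l => [|m IH] w l wA l0.
  by rewrite !big_ord1 => ->; rewrite scale1r.
rewrite [\sum_i l i]big_ord_recl [\sum_i _ *: _]big_ord_recl; set s := \sum_(i < _) _ => l1.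
have s0 : 0 <= s by apply: sumr_ge0 => i _.
have [sE|sN] := eqVneq s 0.
  rewrite big1 ?addr0; last first.
    move=> i _; move/eqP: sE; rewrite psumr_eq0 // => /allP/(_ i).
    by rewrite mem_index_enum => /(_ isT) /= /eqP ->; rewrite scale0r.
  by move: l1; rewrite sE addr0 => ->; rewrite scale1r.
have l_le1 : l ord0 <= 1 by rewrite -l1 lerDl.
have := cA (w ord0) (\sum_(i < m.+1) (l (fintype.lift ord0 i) / s) *: w (fintype.lift ord0 i))
  (Itv01 (l0 ord0) l_le1) (wA _).
have -> : \sum_i l (fintype.lift ord0 i) *: w (fintype.lift ord0 i) =
  (l ord0).~ *: (\sum_(i < m.+1) (l (fintype.lift ord0 i) / s) *: w (fintype.lift ord0 i)).
  rewrite /onem -l1 addrAC subrr add0r scaler_sumr; apply: eq_bigr => i _.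
  by rewrite scalerA mulrCA divff // mulr1.
apply.
apply: IH => [i|i|]; first exact: wA.
- by rewrite divr_ge0.
- by rewrite -mulr_suml divff.
Qed.

Lemma conv_hull_rows {R : realType} m n (W : 'M[R]_(m.+1, n)) :
  conv_hull (range (fun i => row i W)) = [set l *m W | l in simplex m.+1 1].
Proof.
apply/seteqP; split => [x|_ [l [l0 l1] <-] A [cA WA]].
  apply; split => [|_ [i _ <-]].
    move=> _ _ p /set_mem[l [l0 l1] <-] /set_mem[k [k0 k1] <-]; apply/mem_set.
    exists (p%:num *: l + p%:num.~ *: k); last first.
      by rewrite mulmxDl -!scalemxAl.
    split=> [i|]; first by rewrite !mxE addr_ge0 // mulr_ge0 // onem_ge0.
    under eq_bigr do rewrite !mxE.
    by rewrite big_split /= -!mulr_sumr l1 k1 !mulr1 add_onemK.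
  exists (delta_mx 0 i); last by rewrite rowE.
  split=> [j|]; first by rewrite mxE ler0n.
  by rewrite (bigD1 i) //= big1 ?addr0 ?mxE ?eqxx // => j ji; rewrite mxE (negPf ji) andbF.
apply/set_mem; rewrite mulmx_sum_row; apply: convex_set_sum => // i.
by apply/mem_set/WA; exists i.
Qed.

Lemma lattice_polytope_rows {R : realType} n (P : set 'rV[R]_n) :
  lattice_polytope P ->
  exists m (V : 'M[int]_(m.+1, n)),
    P = [set l *m map_mx intr V | l in simplex m.+1 1].
Proof.
move=> [V [/finite_seqP[s ->] [a as0] ->]].
have s0 : (0 < size s)%N by case: s as0.
exists (size s).-1, (\matrix_i nth 0 s i).
rewrite -conv_hull_rows; congr conv_hull; apply/seteqP; split => [_ [b /= bs <-]|_ [i _ <-]].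
  have ib : (index b s < (size s).-1.+1)%N by rewrite prednK // index_mem.
  exists (Ordinal ib) => //; apply/rowP => j.
  by rewrite !mxE /= nth_index.
exists (nth 0 s i); last by apply/rowP => j; rewrite !mxE.
by apply: mem_nth; rewrite -[X in (_ < X)%N](prednK s0).
Qed.

Lemma dilate_simplex {R : realType} m n (W : 'M[R]_(m.+1, n)) (t : nat) :
  dilate t [set l *m W | l in simplex m.+1 1] =
  [set l *m W | l in simplex m.+1 t%:R].
Proof.
apply/seteqP; split => [_ [_ [l [l0 l1] <-] <-]|_ [l [l0 l1] <-]].
  exists (t%:R *: l); last by rewrite -scalemxAl.
  split=> [i|]; first by rewrite mxE mulr_ge0.
  by under eq_bigr do rewrite mxE; rewrite -mulr_sumr l1 mulr1.
(* At [t = 0] the coefficients all vanish, and some point of the polytope must be supplied to be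
   scaled by 0: the first row. *)
case: t l1 => [|t] l1.
  exists (delta_mx 0 ord0 *m W).
    exists (delta_mx 0 ord0) => //; split=> [j|]; first by rewrite mxE ler0n.
    by rewrite (bigD1 ord0) //= big1 ?addr0 ?mxE ?eqxx // => j /negPf j0; rewrite mxE j0.
  suff -> : l = 0 by rewrite mul0mx scale0r.
  apply/rowP => i; move/eqP: l1; rewrite psumr_eq0 // => /allP/(_ i).
  by rewrite mem_index_enum mxE => /(_ isT) /= /eqP.
exists ((t.+1%:R^-1 *: l) *m W); last first.
  by rewrite -scalemxAl scalerA divff ?scale1r // pnatr_eq0.
exists (t.+1%:R^-1 *: l) => //; split=> [i|].
  by rewrite mxE mulr_ge0 // invr_ge0.
by under eq_bigr do rewrite mxE; rewrite -mulr_sumr l1 mulVf // pnatr_eq0.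
Qed.

(** A case of Perron-Frobenius: [t] is an eigenvalue, and the absolute values of a left eigenvector
    form a left eigenvector again. *)
Lemma stationary_vector {R : realType} m (M : 'M[R]_m.+1) (t : R) :
  (forall i j, 0 <= M i j) -> (forall i, \sum_j M i j = t) ->
  exists2 p, simplex m.+1 1 p & p *m M = t *: p.
Proof.
move=> M0 Mt.
have t0 : 0 <= t by rewrite -(Mt ord0) sumr_ge0.
(* The all-ones column is a right eigenvector for [t]; transposing the determinant yields a left
   one. *)
have /det0P[y yN0] : \det (M - t%:M) == 0.
  rewrite -det_tr; apply/det0P; exists (const_mx 1).
    by apply/eqP => /rowP/(_ ord0) /eqP; rewrite !mxE oner_eq0.
  apply/rowP => i; rewrite !mxE.
  under eq_bigr do rewrite !mxE mul1r.
  rewrite sumrB Mt (bigD1 i) //= big1 ?eqxx ?addr0 ?subrr // => j.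
  by rewrite eq_sym => /negPf ->.
rewrite mulmxBr mul_mx_scalar => /eqP; rewrite subr_eq0 => /eqP yM.
pose a : 'rV[R]_m.+1 := \row_j `|y 0 j|.
have le j : (t *: a) 0 j <= (a *m M) 0 j.
  rewrite !mxE -[X in X * _](ger0_norm t0) -normrM.
  have -> : t * y 0 j = (y *m M) 0 j by rewrite yM mxE.
  rewrite mxE; apply: le_trans (ler_norm_sum _ _ _) _; apply: ler_sum => i _.
  by rewrite mxE normrM [X in _ * X]ger0_norm.
(* As the rows sum to [t], both sides of [le] have the same total, which forces equality in each
   coordinate. *)
have sumE : \sum_j ((a *m M) 0 j - (t *: a) 0 j) = 0.
  rewrite sumrB; under eq_bigr do rewrite mxE.
  rewrite exchange_big /= -sumrB big1 // => j _.
  by rewrite -mulr_sumr Mt !mxE mulrC subrr.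
have aM : a *m M = t *: a.
  apply/rowP => j; apply/eqP; rewrite -subr_eq0; move/eqP: sumE.
  rewrite psumr_eq0; last by move=> i _; rewrite subr_ge0.
  by move=> /allP/(_ j); rewrite mem_index_enum => /(_ isT) /=.
have s0 : 0 < \sum_j a 0 j.
  rewrite lt_neqAle sumr_ge0 ?andbT; last by move=> i _; rewrite mxE.
  rewrite eq_sym psumr_eq0; last by move=> i _; rewrite mxE.
  apply: contra yN0 => /allP H; apply/eqP/rowP => j.
  by have := H j; rewrite mem_index_enum !mxE normr_eq0 => /(_ isT) /= /eqP.
exists ((\sum_j a 0 j)^-1 *: a).
  split=> [i|]; first by rewrite !mxE mulr_ge0 // invr_ge0 ltW.
  by under eq_bigr do rewrite mxE; rewrite -mulr_sumr mulVf // gt_eqF.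
by rewrite -scalemxAl aM !scalerA mulrC.
Qed.

Definition lattice_translates {R : realType} {n} (P : set 'rV[R]_n) (t : nat) :
    set (nat * 'rV[int]_n) :=
  [set ia | (ia.1 <= t)%N /\ dilate (t - ia.1) P (lattice_pt R ia.2)].

(* Cancellation of [i P] in [i P + a `<=` i P + (t - i) P]: writing [i v + a],
   for the vertices [v], as combinations of the vertices gives a nonnegative
   matrix with row sums [t]; average over a stationary vector of it. *)
Lemma hgigantures_inE {R : realType} n (P : set 'rV[R]_n) (t : nat) :
  lattice_polytope P -> hgigantures_in P t = lattice_translates P t.
Proof.
move=> /lattice_polytope_rows[m [V ->]]; set W := map_mx intr V.
apply/seteqP; split => -[i a] [/= it]; rewrite /hgiganture !dilate_simplex.
  move=> sub; split=> //; rewrite dilate_simplex.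
  have rowP k : exists r, simplex m.+1 t%:R r /\ r *m W = i%:R *: row k W + lattice_pt R a.
    have [r rt rW] : [set l *m W | l in simplex m.+1 t%:R] (i%:R *: row k W + lattice_pt R a).
      apply: sub; exists (i%:R *: row k W) => //.
      exists (i%:R *: delta_mx 0 k); last by rewrite -scalemxAl rowE.
      split=> [j|]; first by rewrite !mxE mulr_ge0 // ler0n.
      under eq_bigr do rewrite mxE.
      rewrite -mulr_sumr (bigD1 k) //= big1 ?addr0 ?mxE ?eqxx ?mulr1 // => j jk.
      by rewrite mxE (negPf jk) andbF.
    by exists r.
  have [r rP] := choice rowP.
  have [p [p0 p1] pM] : exists2 p, simplex m.+1 1 p & p *m \matrix_k r k = t%:R *: p.
    apply: stationary_vector => [k j|k].
      by rewrite mxE; case: (rP k) => -[].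
    by under eq_bigr do rewrite mxE; case: (rP k) => -[].
  have MW : \matrix_k r k *m W = i%:R *: W + \matrix_(k < m.+1) lattice_pt R a.
    apply/row_matrixP => k; rewrite row_mul rowK (rP k).2 linearD linearZ /=.
    by rewrite rowK.
  have pa : p *m \matrix_(k < m.+1) lattice_pt R a = lattice_pt R a.
    rewrite mulmx_sum_row; under eq_bigr do rewrite rowK.
    by rewrite -scaler_suml p1 scale1r.
  exists ((t - i)%:R *: p).
    split=> [j|]; first by rewrite mxE mulr_ge0.
    by under eq_bigr do rewrite mxE; rewrite -mulr_sumr p1 mulr1.
  have := congr1 (mulmx p) MW; rewrite mulmxA pM mulmxDr pa -scalemxAr -scalemxAl.
  by rewrite natrB // -scalemxAl scalerBl => ->; rewrite addrAC subrr add0r.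
move=> -[l [l0 lt] la]; split=> //=.
rewrite /hgiganture !dilate_simplex => y [_ [k [k0 ki] <-] <-] /=.
exists (k + l); last by rewrite mulmxDl la.
split=> [j|]; first by rewrite mxE addr_ge0.
by under eq_bigr do rewrite mxE; rewrite big_split /= ki lt -natrD subnKC.
Qed.

(** * The pulling triangulation *)

Definition lexpos {R : realType} {m} (u : 'rV[R]_m) :=
  exists i, 0 < u 0 i /\ forall j : 'I_m, (j < i)%N -> u 0 j = 0.

Lemma lexpos_total {R : realType} m (u : 'rV[R]_m) :
  u != 0 -> lexpos u \/ lexpos (- u).
Proof.
move=> u0; have [i0 ui0] : exists i, u 0 i != 0.
  apply/existsP; apply: contraNT u0 => /existsPn u0; apply/eqP/rowP => i.
  by rewrite mxE; have := u0 i; rewrite negbK => /eqP.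
case: (@arg_minnP _ i0 (fun i => u 0 i != 0) (fun i => val i) ui0) => i ui imin.
have below (j : 'I_m) : (j < i)%N -> u 0 j = 0.
  by move=> ji; apply/eqP; apply: contraTT ji => /imin; rewrite -leqNgt.
case: (ltrgtP (u 0 i) 0) => [ui_lt0|ui_gt0|/eqP]; last by rewrite (negPf ui).
  by right; exists i; rewrite mxE oppr_gt0; split=> // j /below uj; rewrite mxE uj oppr0.
by left; exists i.
Qed.

Lemma closed_preimage {T U : topologicalType} (f : T -> U) (D : set U) :
  continuous f -> closed D -> closed (f @^-1` D).
Proof. by move=> cf; apply: preimage_closed => x _; exact: cf. Qed.

Lemma compact_lexmax {R : realType} m (A : set 'rV[R]_m) :
  compact A -> A !=set0 ->
  exists2 a, A a & forall b, A b -> ~ lexpos (b - a).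
Proof.
move=> cA A0.
(* [B] collects the points of [A] whose first [k] coordinates are lexicographically largest. The
   last clause lets the next maximum over [B] bound every point of [A] with the same prefix. *)
have H k : (k <= m)%N -> exists B : set 'rV[R]_m,
    [/\ compact B, B !=set0, B `<=` A,
        forall b a, B b -> A a -> forall i : 'I_m, (i < k)%N ->
          (forall j : 'I_m, (j < i)%N -> a 0 j = b 0 j) -> a 0 i <= b 0 i &
        forall b a, B b -> A a ->
          (forall i : 'I_m, (i < k)%N -> a 0 i = b 0 i) -> B a].
  elim: k => [|k IH] km; first by exists A; split.
  have [B [cB B0 BA Bmax Beq]] := IH (ltnW km).
  pose i0 := Ordinal km.
  have cont : continuous (fun x : 'rV[R]_m => x 0 i0) by exact: coord_continuous.
  have [c /set_mem Bc cmax] : exists2 c, c \in B &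
      forall x, x \in B -> x 0 i0 <= c 0 i0.
    by apply: EVT_max_rV => //; exact: continuous_subspaceT.
  exists (B `&` [set x | x 0 i0 = c 0 i0]); split.
  - apply: compact_closedI => //.
    exact: (closed_preimage _ _ cont (closed_eq (y := c 0 i0))).
  - by exists c.
  - by move=> x [/BA].
  - move=> b a [Bb bc] Aa i; rewrite ltnS leq_eqVlt => /predU1P[ik|ik]; last exact: Bmax.
    have -> : i = i0 by exact: val_inj.
    move=> ab; rewrite bc; apply/cmax/mem_set.
    by apply: (Beq b) => // j jk; apply: ab.
  - move=> b a [Bb bc] Aa ab; split; first by apply: (Beq b) => // j jk; exact/ab/ltnW.
    by rewrite /= ab //= bc.
have [B [cB [b Bb] BA Bmax _]] := H m (leqnn m).
exists b => [|a Aa [i []]]; first exact: BA.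
rewrite !mxE subr_gt0 => /lt_geF ba ab.
by rewrite (Bmax b a) // in ba => j /ab; rewrite !mxE => /eqP; rewrite subr_eq0 => /eqP.
Qed.

Section Optimal.
Context {R : realType} {m n : nat} (W : 'M[R]_(m.+1, n)).
Implicit Types (u l : 'rV[R]_m.+1) (S T : {set 'I_m.+1}).

Definition affine_relation u := u *m W = 0 /\ \sum_i u 0 i = 0.

Definition support l := [set i | l 0 i != 0]%SET.

(* The supports of the lexicographically largest representations [l *m W] of
   points: these are the faces of the pulling triangulation of the rows of
   [W], and they are described here without reference to a point. *)
Definition optimal S :=
  forall u, affine_relation u -> (forall i, i \notin S -> 0 <= u 0 i) ->
  ~ lexpos u.

(** A direction nonnegative off [S] is nonnegative off [T]. Thus the optimal sets form a simplicial
    complex. *)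
Lemma optimalS S T : S \subset T -> optimal T -> optimal S.
Proof.
move=> ST oT u ru u0; apply: oT => // i iT; apply: u0.
by apply: contra iT => /(fintype.subsetP ST).
Qed.

(* Priority goes to the first coordinate, so every face extends to a face
   with the first vertex. *)
Lemma optimal_setU0 S : optimal S -> optimal (ord0 |: S).
Proof.
move=> oS u ru u0 pu; apply: (oS u) => // i iS.
(* A lexicographically positive [u] has a nonnegative first coordinate. *)
have [->|i0] := eqVneq i ord0; last by apply: u0; rewrite !inE negb_or i0.
case: pu => -[[|k] km] [uk ulow]; last by rewrite ulow.
by apply: ltW; rewrite (_ : ord0 = Ordinal km) //; exact: val_inj.
Qed.

Lemma compact_simplex_fiber (t : R) (x : 'rV[R]_n) :
  compact (simplex m.+1 t `&` [set l | l *m W = x]).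
Proof.
have cont (f : 'I_m.+1 -> R) : continuous (fun l : 'rV[R]_m.+1 => \sum_i l 0 i * f i).
  apply: continuous_big => [|i _ l]; first exact: add_continuous.
  by apply: (@continuousM _ _ (fun l : 'rV[R]_m.+1 => l 0 i) (cst (f i)));
    [exact: coord_continuous|exact: cst_continuous].
have E : simplex m.+1 t `&` [set l | l *m W = x] =
    (\bigcap_i [set l | 0 <= l 0 i]) `&` [set l | \sum_i l 0 i * 1 = t] `&`
    (\bigcap_j [set l | \sum_i l 0 i * W i j = x 0 j]).
  have sum1 l : \sum_i l 0 i * 1 = \sum_(i < m.+1) l 0 i :> R.
    by apply: eq_bigr => i _; rewrite mulr1.
  apply/seteqP; split=> l [[l0 l1] lx].
    split; first by split=> [i _|/=]; [exact: l0|rewrite sum1].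
    by move=> j _ /=; rewrite -lx mxE.
  split; first by split=> [i|]; [exact: l0|rewrite -sum1].
  by apply/rowP => j; rewrite mxE; exact: lx.
apply: (@subclosed_compact _ _ [set l : 'rV[R]_m.+1 | forall i, `[0, t]%classic (l ord0 i)]).
- rewrite E; apply: closedI; first apply: closedI.
  + apply: closed_bigI => i _.
    apply: (closed_preimage (fun l : 'rV[R]_m.+1 => l 0 i) _ _ (closed_ge (y := 0))).
    exact: coord_continuous.
  + exact: (closed_preimage _ _ (cont (fun=> 1)) (closed_eq (y := t))).
  + apply: closed_bigI => j _.
    exact: (closed_preimage _ _ (cont (W^~ j)) (closed_eq (y := x 0 j))).
- exact: (@rV_compact R m.+1 (fun=> `[0, t]%classic) (fun=> segment_compact (a := 0) (b := t))).
- move=> l [[l0 <-] _] i; rewrite /= in_itv /= l0 /= (bigD1 i) //= lerDl.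
  by apply: sumr_ge0 => j _.
Qed.

(** Take the lexicographic maximum of the compact fiber: a relation violating optimality of its
    support would allow a small step to a larger representation. *)
Lemma optimal_exists (t : R) l : simplex m.+1 t l ->
  exists l', [/\ simplex m.+1 t l', l' *m W = l *m W & optimal (support l')].
Proof.
move=> tl.
have [|a [[a0 at_] aW] amax] := compact_lexmax _ _ (compact_simplex_fiber t (l *m W)).
  by exists l.
exists a; split=> // u [uW u0] upos [i [ui ulow]].
(* This makes [|u_j| / s <= a_j] on the support, so the step [s^-1 *: u] keeps all coordinates
   nonnegative; the summand 1 makes [s] positive. *)
pose s := 1 + \sum_(j | a 0 j != 0) `|u 0 j| / a 0 j.
have s0 : 0 < s by rewrite ltr_pwDl // sumr_ge0 // => j _; rewrite divr_ge0.
apply: (amax (a + s^-1 *: u)).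
  split; last by rewrite /= mulmxDl -scalemxAl uW scaler0 addr0.
  split=> [j|]; last first.
    under eq_bigr do rewrite !mxE.
    by rewrite big_split /= -mulr_sumr u0 mulr0 addr0.
  rewrite !mxE; have [aj|aj] := eqVneq (a 0 j) 0.
    by rewrite aj add0r mulr_ge0 // ?invr_ge0 ?(ltW s0) // upos // inE aj eqxx.
  have aj_gt0 : 0 < a 0 j by rewrite lt_neqAle eq_sym aj a0.
  have : `|u 0 j| / a 0 j <= s.
    rewrite /s (bigD1 j) //= addrCA lerDl addr_ge0 // sumr_ge0 // => k _.
    by rewrite divr_ge0.
  rewrite ler_pdivrMr // -ler_pdivrMl // => le.
  rewrite -lerBlDr sub0r -mulrN; apply: le_trans le.
  by rewrite ler_wpM2l ?invr_ge0 ?(ltW s0) // -normrN ler_norm.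
rewrite addrAC subrr add0r; exists i; split; first by rewrite mxE mulr_gt0 ?invr_gt0.
by move=> j /ulow uj; rewrite mxE uj mulr0.
Qed.

(** The difference is an affine relation, nonnegative off the support of the subtracted vector, so
    neither it nor its opposite can be lexicographically positive. *)
Lemma optimal_unique (t : R) l l' :
  simplex m.+1 t l -> simplex m.+1 t l' -> l *m W = l' *m W ->
  optimal (support l) -> optimal (support l') -> l = l'.
Proof.
have nlex k k' : simplex m.+1 t k -> simplex m.+1 t k' -> k *m W = k' *m W ->
    optimal (support k') -> ~ lexpos (k - k').
  move=> [k0 kt] [k'0 k't] kk ok'; apply: ok'.
    split; first by rewrite mulmxBl kk subrr.
    by under eq_bigr do rewrite !mxE; rewrite sumrB kt k't subrr.
  by move=> i; rewrite inE negbK !mxE => /eqP ->; rewrite subr0.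
move=> tl tl' ll ol ol'; apply/eqP; rewrite -subr_eq0; apply/negPn/negP.
by move=> /lexpos_total[|]; rewrite ?opprB; exact: nlex.
Qed.

End Optimal.

(** * Finiteness and counting tools *)

Lemma finite_lattice_translates {R : realType} n (P : set 'rV[R]_n) (t : nat) :
  lattice_polytope P -> finite_set (lattice_translates P t).
Proof.
move=> /lattice_polytope_rows[m [V ->]].
(* Coefficients are at most [t], so coordinates lie in [[-N, N]]; [f] decodes them from ordinals
   shifted by [N]. *)
pose N := (t * \sum_k \sum_j absz (V k j))%N.
pose f (x : 'I_t.+1 * 'rV['I_(N + N).+1]_n) : nat * 'rV[int]_n :=
  (val x.1, \row_j ((x.2 0 j : nat)%:Z - N%:Z)).
apply: sub_finite_set (finite_image f (@finite_finset _ setT)).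
move=> [i a] [/= it]; rewrite dilate_simplex => -[l [l0 lt] la].
have aN j : `|a 0 j| <= N%:Z.
  rewrite -(ler_int R) intr_norm.
  have -> : (a 0 j)%:~R = \sum_k l 0 k * (V k j)%:~R :> R.
    have := congr1 (fun x : 'rV[R]_n => x 0 j) la; rewrite !mxE => <-.
    by apply: eq_bigr => k _; rewrite mxE.
  apply: le_trans (ler_norm_sum _ _ _) _.
  rewrite /N PoszM intrM -[X in _ <= X * _]/(t%:R) -[X in _ <= _ * X]/(_%:R) natr_sum mulr_sumr.
  apply: ler_sum => k _; rewrite normrM (ger0_norm (l0 k)).
  apply: ler_pM => //.
    apply: (@le_trans _ _ (t - i)%:R); last by rewrite ler_nat leq_subr.
    by rewrite -lt (bigD1 k) //= lerDl sumr_ge0.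
  rewrite -intr_norm -abszE -[X in X <= _]/(_%:R) ler_nat (bigD1 j) //=.
  exact: leq_addr.
exists (Ordinal (it : (i < t.+1)%N), \row_j inord (absz (a 0 j + N%:Z))) => //.
congr pair; apply/rowP => j; rewrite !mxE /=.
have := aN j; rewrite ler_norml => /andP[aN1 aN2].
have aN0 : 0 <= a 0 j + N%:Z by rewrite -lerBlDr sub0r.
rewrite inordK ?gez0_abs ?addrK //.
by rewrite ltnS -lez_nat gez0_abs // PoszD lerD2r.
Qed.

Lemma card_fibers {T U : choiceType} (A : {fset T}) (B : {fset U}) (f : T -> U) :
  (forall x, x \in A -> f x \in B) ->
  #|` A| = (\sum_(b <- B) #|` [fset x in A | f x == b]%fset|)%N.
Proof.
move=> AB; rewrite card_fset_sum1.
under [RHS]eq_bigr do rewrite card_fset_sum1 -big_fset_condE.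
rewrite (exchange_big_dep xpredT) //= big_seq [RHS]big_seq.
apply: eq_bigr => x xA; rewrite sum1_count.
under eq_count do rewrite eq_sym.
by rewrite count_uniq_mem ?fset_uniq // AB.
Qed.

Lemma binomial_poly (c d : nat) :
  exists p : {poly rat}, forall t : nat, p.[t%:R] = 'C(t + c, d)%:R.
Proof.
have [q qE] : exists q : {poly rat}, forall t : nat, q.[t%:R] = ((t + c) ^_ d)%:R.
  elim: d => [|d [q qE]]; first by exists 1 => t; rewrite hornerC ffactn0.
  exists (q * ('X + (c%:R - d%:R)%:P)) => t.
  rewrite hornerM qE hornerD hornerX hornerC ffactnSr natrM.
  (* If [t + c < d], natural subtraction truncates, but the falling factorial in front is already
     0. *)
  have [dtc|tcd] := leqP d (t + c); first by rewrite natrB // natrD addrA.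
  by rewrite ffact_small // !mul0r.
exists ((d`!)%:R^-1 *: q) => t; rewrite hornerZ qE -bin_ffact natrM mulrC mulfK //.
Qed.

(** * Integral and fractional parts of coordinates *)

(** For [x > 0] the second branch leaves a remainder in [(0, 1]]; at 0 the truncated predecessor
    gives 0. So, for [x >= 0] and away from [ord0], the remainder vanishes exactly when [x] does. *)
Definition integral_part {R : realType} {m} (i : 'I_m.+1) (x : R) : nat :=
  if i == ord0 then Num.truncn x else (absz (Num.ceil x)).-1.

(* The box of a half-open cone: the first coordinate lives in [0, 1), the
   others in (0, 1], or are 0 together with their integral part [k]. *)
Definition boxed {R : realType} {m} (i : 'I_m.+1) (b : R) (k : nat) :=
  if i == ord0 then 0 <= b < 1 : Prop
  else 0 <= b <= 1 /\ (b = 0 -> k = 0%N).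

Lemma integral_partP {R : realType} {m} (i : 'I_m.+1) (x : R) :
  0 <= x -> boxed i (x - (integral_part i x)%:R) (integral_part i x).
Proof.
rewrite /boxed /integral_part => x0; case: eqP => _.
  have /andP[h1 h2] := truncn_itv x0.
  by rewrite subr_ge0 h1 ltrBlDl natr1.
have [->|xN] := eqVneq x 0.
  by rewrite ceil0 /= subrr lexx ler01.
have xgt : 0 < x by rewrite lt_neqAle eq_sym xN.
have cgt : 0 < Num.ceil x by rewrite ceil_gt0.
have /andP[h1 h2] := ceil_itv x.
have -> : (absz (Num.ceil x)).-1%:R = (Num.ceil x - 1)%:~R :> R.
  case: (Num.ceil x) cgt => // -[|k] // _.
  by rewrite absz_nat /= -addn1 PoszD addrK.
split; first by rewrite subr_ge0 ltW //= lerBlDl -intrD1 subrK.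
by move/eqP; rewrite subr_eq0 => /eqP xE; rewrite {2}xE ltxx in h1.
Qed.

Lemma integral_partE {R : realType} {m} (i : 'I_m.+1) (b : R) k :
  boxed i b k -> integral_part i (b + k%:R) = k.
Proof.
rewrite /boxed /integral_part; case: eqP => _.
  by move=> /andP[b0 b1]; apply: truncn_def; rewrite lerDr b0 /= -natr1 addrC ltrD2l.
move=> [/andP[b0 b1]]; have [->|bN] := eqVneq b 0.
  by move=> /(_ erefl) ->; rewrite addr0 ceil0.
move=> _; rewrite (@ceil_def _ _ (k.+1)%:Z) //.
rewrite -addn1 PoszD addrK intrD [b + _]addrC lerD2l b1 andbT.
by rewrite ltrDl lt_neqAle eq_sym bN.
Qed.

(** * Counting by boxes *)

Section BoxCount.
Context {R : realType} {m n : nat} (V : 'M[int]_(m.+1, n)).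
Implicit Types l b : 'rV[R]_m.+1.
Let W : 'M[R]_(m.+1, n) := map_mx intr V.

Definition representations (t : nat) : set 'rV[R]_m.+1 :=
  [set l : 'rV[R]_m.+1 | [/\ forall i, 0 <= l 0 i,
    exists2 j, (j <= t)%N & \sum_i l 0 i = j%:R,
    exists a, l *m W = lattice_pt R a & optimal W (support l)]].

Let P := [set l *m W | l in simplex m.+1 (1 : R)].

(** A pair [(i, a)] goes to the optimal representation of [a] of weight [t - i]. Weight and image
    recover the pair; uniqueness of optimal representations gives surjectivity. *)
Lemma representations_bij (t : nat) :
  exists f, {in lattice_translates P t &, injective f} /\
    f @` lattice_translates P t = representations t.
Proof.
have /choice[f fP] (ia : nat * 'rV[int]_n) : exists l : 'rV[R]_m.+1, lattice_translates P t ia ->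
    [/\ simplex m.+1 (t - ia.1)%:R l, l *m W = lattice_pt R ia.2 & optimal W (support l)].
  have [[_]|] := pselect (lattice_translates P t ia); last by exists 0.
  rewrite /P dilate_simplex => -[l ls la].
  by have [l' [? l'l ?]] := optimal_exists W _ _ ls; exists l'; rewrite l'l.
exists f; split.
  move=> [i a] [j b] /set_mem ia /set_mem jb fE.
  have [[_ si] ai _] := fP _ ia; have [[_ sj] bj _] := fP _ jb.
  case: ia jb => /= it _ [/= jt _].
  have ij : i = j.
    move: si; rewrite fE sj => /eqP; rewrite eqr_nat /= => /eqP tij.
    by rewrite -(subKn it) -(subKn jt) tij.
  rewrite ij; congr pair; apply/rowP => k; apply: (@intr_inj R).
  have : lattice_pt R a = lattice_pt R b by rewrite -ai -bj fE.
  by move=> /rowP/(_ k); rewrite !mxE.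
apply/seteqP; split=> [_ [ia tia <-]|l [l0 [j jt lj] [a la] ol]].
  have [[l0 l1] la ol] := fP _ tia; split=> //.
    by exists (t - ia.1)%N; rewrite ?leq_subr.
  by exists ia.2.
have tia : lattice_translates P t ((t - j)%N, a).
  split=> /=; first exact: leq_subr.
  by rewrite subKn // /P dilate_simplex; exists l.
exists ((t - j)%N, a) => //; have [/=] := fP _ tia; rewrite subKn // => fs fa ofl.
by apply: (optimal_unique W j%:R) => //; rewrite fa.
Qed.

Let latP : lattice_polytope P.
Proof.
exists (range (fun i => row i V)); split.
- by apply: finite_image; exact: finite_finset.
- by exists (row ord0 V); exists ord0.
rewrite /P -conv_hull_rows; congr conv_hull; apply/seteqP; split=> x [].
  by move=> i _ <-; exists (row i V); [exists i|rewrite /lattice_pt map_row].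
by move=> _ [i _ <-] <-; exists i => //; rewrite /lattice_pt map_row.
Qed.

Lemma finite_representations (t : nat) : finite_set (representations t).
Proof.
by have [f [_ <-]] := representations_bij t; apply/finite_image/finite_lattice_translates.
Qed.

Lemma Hcount_representations (t : nat) :
  Hcount P t = #|` fset_set (representations t)|.
Proof.
have [f [finj <-]] := representations_bij t.
have fin := finite_lattice_translates _ P t latP.
rewrite /Hcount hgigantures_inE // fset_set_image // card_in_imfset //.
by move=> x y /=; rewrite !in_fset_set // => ? ?; exact: finj.
Qed.

Definition int_part l (i : 'I_m.+1) : nat := integral_part i (l 0 i).

Definition box_part l : 'rV[R]_m.+1 :=
  \row_i (l 0 i - (int_part l i)%:R).

Lemma boxed_box_part l i : (forall i, 0 <= l 0 i) ->
  boxed i (box_part l 0 i) (int_part l i).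
Proof. by move=> l0; rewrite mxE; exact: integral_partP. Qed.

Lemma boxed_ge0 i (x : R) k : boxed (m := m) i x k -> 0 <= x.
Proof. by rewrite /boxed; case: eqP => _ => [/andP[]|[/andP[]]]. Qed.

Lemma boxed_le1 i (x : R) k : boxed (m := m) i x k -> x <= 1.
Proof. by rewrite /boxed; case: eqP => _ => [/andP[_ /ltW]|[/andP[]]]. Qed.

Lemma boxed0 i (x : R) k : boxed (m := m) i x k -> boxed i x 0.
Proof. by rewrite /boxed; case: eqP => // _ []. Qed.

Lemma box_partE b (k : 'I_m.+1 -> nat) : (forall i, boxed i (b 0 i) (k i)) ->
  box_part (\row_i (b 0 i + (k i)%:R)) = b.
Proof.
move=> bk; apply/rowP => i.
by rewrite !mxE /int_part mxE integral_partE ?addrK.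
Qed.

(** The [m.+1] coordinates of a box part are at most 1, so the weight bound [m.+1] loses none of
    them. *)
Definition box_points : set 'rV[R]_m.+1 :=
  [set b | representations m.+1 b /\ box_part b = b].

Lemma row_natE (k : 'I_m.+1 -> nat) :
  \row_i (k i)%:R = map_mx intr (\row_i (k i)%:Z) :> 'rV[R]_m.+1.
Proof. by apply/rowP => i; rewrite !mxE. Qed.

Lemma sum_box_part l : \sum_i l 0 i =
  \sum_i box_part l 0 i + (\sum_i int_part l i)%:R.
Proof.
rewrite natr_sum -big_split /=; apply: eq_bigr => i _.
by rewrite mxE subrK.
Qed.

(** Removing integral parts subtracts an integer combination of the rows of [V]: the image stays in
    the lattice, the weight stays integral, and the support does not grow. *)
Lemma box_part_points t l : representations t l -> box_points (box_part l).
Proof.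
move=> [l0 [j jt lj] [a la] ol].
have bl i := boxed_box_part l i l0.
have bl0 i : boxed i (box_part l 0 i) 0 by exact: boxed0 (bl i).
have bb := box_partE (box_part l) (fun=> 0%N) bl0.
split; last first.
  rewrite -[RHS]bb; congr box_part.
  by apply/rowP => i; rewrite [RHS]mxE addr0.
have b0 i : 0 <= box_part l 0 i := boxed_ge0 _ _ _ (bl i).
split=> //.
- have kj : (\sum_i int_part l i <= j)%N.
    by rewrite -(ler_nat R) -lj sum_box_part lerDr sumr_ge0.
  have sE : \sum_i box_part l 0 i = (j - \sum_i int_part l i)%:R.
    by rewrite natrB //; apply: (canRL (addrK _)); rewrite -sum_box_part.
  exists (j - \sum_i int_part l i)%N => //.
  rewrite -(ler_nat R) -sE; apply: (@le_trans _ _ (\sum_(i < m.+1) 1)).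
    by apply: ler_sum => i _; exact: boxed_le1 (bl i).
  by rewrite sumr_const card_ord.
- exists (a - (\row_i (int_part l i)%:Z) *m V).
  have -> : box_part l = l - \row_i (int_part l i)%:R.
    by apply/rowP => i; rewrite !mxE.
  by rewrite mulmxBl la row_natE -map_mxM /lattice_pt map_mxB.
- apply: optimalS ol; apply/fintype.subsetP => i; rewrite !inE.
  apply: contra => /eqP li; have := b0 i.
  by rewrite mxE li sub0r oppr_ge0 oppr_eq0 eq_le ler0n => ->.
Qed.

(** For [t >= h] the fiber consists of the [b + k] with [k] a natural vector supported on [T] of sum
    at most [t - h]; stars and bars counts them. *)
Lemma card_fiber (b : 'rV[R]_m.+1) : box_points b ->
  exists c d, forall t,
    #|` [fset l in fset_set (representations t) | box_part l == b]%fset| = 'C(t + c, d).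
Proof.
move=> [[b0 [h _ bh] [a ba] ob] bb].
have bx i : boxed i (b 0 i) 0.
  by rewrite -bb; exact: boxed0 (boxed_box_part b i b0).
pose T := (ord0 |: support b)%SET.
have T0 : ord0 \in T by rewrite !inE eqxx.
(* Coordinates in [T] are at most 1, and the one at [ord0] is strictly smaller. *)
have hT : (h < #|T|)%N.
  rewrite -(ltr_nat R) -bh (bigID (mem T)) /= [X in _ + X]big1 ?addr0; last first.
    by move=> i; rewrite !inE negb_or negbK => /andP[_ /eqP].
  rewrite -sumr_const (bigD1 ord0) //= [X in _ < X](bigD1 ord0) //=.
  apply: ltr_leD; first by have /andP[] : 0 <= b 0 ord0 < 1 := bx ord0.
  by apply: ler_sum => i _; exact: boxed_le1 (bx i).
exists (#|T| - h)%N, #|T| => t.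
have fiber0 l : representations t l -> box_part l = b ->
    (h + \sum_i int_part l i <= t)%N.
  move=> [_ [j jt lj] _ _] lb; apply: leq_trans jt.
  by rewrite -(ler_nat R) natrD -bh -lb -sum_box_part lj.
(* For [t < h] the fiber is empty, and the binomial vanishes too, because
   [t + (#|T| - h) < #|T|]. *)
have [th|ht] := ltnP t h.
  rewrite bin_small; last first.
    by rewrite addnBA ?ltn_subLR ?(leq_trans (ltnW hT)) ?leq_addl ?ltn_add2r // ltnW.
  apply/eqP; rewrite cardfs_eq0; apply/eqP/fsetP => l; rewrite !inE.
  apply/negP => /andP[]; rewrite in_fset_set; last exact: finite_representations.
  move=> /set_mem lt /eqP lb; have := fiber0 _ lt lb.
  by rewrite leqNgt (leq_trans th) // leq_addr.
rewrite addnBCA // ?(ltnW hT) // -card_partial_ord_partitions.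
pose k (x : #|T|.-tuple 'I_(t - h).+1) (i : 'I_m.+1) : nat :=
  if i \in T then nat_of_ord (tnth x (enum_rank_in T0 i)) else 0%N.
pose g x : 'rV[R]_m.+1 := \row_i (b 0 i + (k x i)%:R).
have bk x i : boxed i (b 0 i) (k x i).
  have := bx i; rewrite /boxed /k; case: eqP => // i0 [b01 _]; split=> // bi.
  by rewrite !inE bi eqxx orbF; case: eqP.
have gb x : box_part (g x) = b := box_partE b (k x) (bk x).
have sumk x : (\sum_i k x i = \sum_(i <- x) i)%N.
  rewrite (bigID (mem T)) /= [X in (_ + X)%N]big1 ?addn0; last first.
    by move=> i iT; rewrite /k (negPf iT).
  rewrite (big_enum_val (A := mem T)) big_tuple; apply: eq_bigr => i _.
  by rewrite /k enum_valP enum_valK_in.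
have gt (x : #|T|.-tuple 'I_(t - h).+1) : (\sum_(i <- x) i <= t - h)%N -> representations t (g x).
  move=> xt; split.
  - by move=> i; rewrite /g mxE addr_ge0.
  - exists (h + \sum_(i <- x) i)%N; first by rewrite -leq_subRL.
    rewrite (eq_bigr (fun i => b 0 i + (k x i)%:R)); last first.
      by move=> i _; rewrite mxE.
    by rewrite big_split /= bh natrD -sumk natr_sum.
  - exists (a + (\row_i (k x i)%:Z) *m V).
    have -> : g x = b + \row_i (k x i)%:R by apply/rowP => i; rewrite !mxE.
    by rewrite mulmxDl ba row_natE -map_mxM /lattice_pt map_mxD.
  (* The first coordinate may become nonzero where [b] vanishes; the cone property keeps the support
     optimal. *)
  - apply: optimalS (optimal_setU0 W _ ob); apply/fintype.subsetP => i.
    apply: contraLR => iT; rewrite inE /g mxE /k (negPf iT) addr0.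
    by move: iT; rewrite !inE negb_or => /andP[].
rewrite -card_finset; set F := (X in _ = #|` X|).
have ginj : {in F &, injective g}.
  move=> x y _ _ /rowP gxy; apply: eq_from_tnth => i; apply: val_inj.
  have := gxy (enum_val i); rewrite /g !mxE => /addrI/eqP; rewrite eqr_nat => /eqP.
  by rewrite /k enum_valP enum_valK_in.
rewrite (_ : [fset l in _ | _]%fset = [fset g x | x in F]%fset); first by rewrite card_in_imfset.
apply/fsetP => l; rewrite !inE in_fset_set; last exact: finite_representations.
apply/andP/imfsetP => [[/set_mem lt /eqP lb]|[x /= xs ->]]; last first.
  by rewrite gb eqxx; split=> //; apply/mem_set/gt; move: xs; rewrite !inE.
have kt := fiber0 _ lt lb.
have l0 : forall i, 0 <= l 0 i by case: lt.
have klt i : (int_part l i <= t - h)%N.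
  by rewrite leq_subRL // (leq_trans _ kt) // leq_add2l (bigD1 i) //= leq_addr.
(* The preimage of [l] lists its integral parts along [T]; off [T] they are 0, since [b] vanishes
   there. *)
pose x := [tuple inord (int_part l (enum_val i)) : 'I_(t - h).+1 | i < #|T|].
have kx i : k x i = int_part l i.
  rewrite /k; case: ifPn => iT; first by rewrite tnth_mktuple enum_rankK_in ?inordK ?ltnS.
  have := boxed_box_part l i l0; rewrite lb /boxed.
  move: iT; rewrite !inE negb_or negbK => /andP[/negPf -> /eqP bi] [_ /(_ bi)].
  by [].
exists x.
  rewrite /= !inE -sumk; under eq_bigr do rewrite kx.
  by rewrite leq_subRL.
by apply/rowP => i; rewrite /g mxE kx -lb mxE subrK.
Qed.

(** The fibers over the finitely many box points partition the representations, and each has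
    polynomial size. *)
Lemma Hcount_rows_poly : exists p : {poly rat}, forall t : nat, p.[t%:R] = (Hcount P t)%:R.
Proof.
have finB : finite_set box_points.
  by apply: sub_finite_set (finite_representations m.+1) => b [].
have fiberP (b : 'rV[R]_m.+1) : exists p : {poly rat}, box_points b -> forall t : nat,
    p.[t%:R] = #|` [fset l in fset_set (representations t) | box_part l == b]%fset|%:R.
  have [Bb|] := pselect (box_points b); last by exists 0.
  have [c [d cd]] := card_fiber b Bb; have [p pE] := binomial_poly c d.
  by exists p => _ t; rewrite pE cd.
have [p pP] := choice fiberP.
exists (\sum_(b <- fset_set box_points) p b) => t.
rewrite Hcount_representations (card_fibers _ (fset_set box_points) box_part); last first.
  move=> l; rewrite !in_fset_set //; last exact: finite_representations.
  by move=> /set_mem /box_part_points /mem_set.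
rewrite horner_sum natr_sum big_seq [RHS]big_seq; apply: eq_bigr => b.
by rewrite in_fset_set // => /set_mem Bb; rewrite (pP b Bb).
Qed.

End BoxCount.

(** * The valuation property *)

Lemma lattice_polytope_nonempty {R : realType} n (P : set 'rV[R]_n) :
  lattice_polytope P -> P !=set0.
Proof.
move=> [V [_ [a Va] ->]]; exists (lattice_pt R a) => A [_ VA].
by apply: VA; exists a.
Qed.

(* For [k = 0] both sides are the origin, provided [P] and [Q] meet. *)
Lemma dilateI {R : realType} n k (P Q : set 'rV[R]_n) : P `&` Q !=set0 ->
  dilate k (P `&` Q) = dilate k P `&` dilate k Q.
Proof.
move=> [z [Pz Qz]]; apply/seteqP; split=> [_ [x [Px Qx] <-]|x [[y Py <-] [y' Qy' yy']]].
  by split; exists x.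
case: k yy' => [|k] yy'; first by exists z => //; rewrite !scale0r.
have k0 : k.+1%:R != 0 :> R by rewrite pnatr_eq0.
exists y => //; split=> //.
by rewrite -[y](scalerK k0) -yy' scalerK.
Qed.

Lemma Hcount_valuation {R : realType} n (P Q : set 'rV[R]_n) t :
  lattice_polytope P -> lattice_polytope Q ->
  lattice_polytope (P `|` Q) -> lattice_polytope (P `&` Q) ->
  (Hcount (P `|` Q) t + Hcount (P `&` Q) t = Hcount P t + Hcount Q t)%N.
Proof.
move=> lP lQ lU lI; rewrite /Hcount !hgigantures_inE //.
have finP := finite_lattice_translates _ _ t lP.
have finQ := finite_lattice_translates _ _ t lQ.
have -> : lattice_translates (P `|` Q) t = lattice_translates P t `|` lattice_translates Q t.
  have dilateU k : dilate k (P `|` Q) = dilate k P `|` dilate k Q by exact: image_setU.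
  rewrite /lattice_translates; apply/seteqP.
  split=> -[i a] /=; rewrite dilateU.
    by move=> [it] []; [left|right].
  by move=> [] [it ia]; split=> //; [left|right].
have -> : lattice_translates (P `&` Q) t = lattice_translates P t `&` lattice_translates Q t.
  (* For disjoint [P] and [Q] the identity would fail at [i = t], where both dilates are the
     origin. *)
  have PQ := lattice_polytope_nonempty _ _ lI.
  rewrite /lattice_translates; apply/seteqP.
  split=> -[i a] /=; rewrite dilateI //.
    by move=> [it []].
  by move=> [[it Pa] [_ Qa]].
by rewrite (fset_setU finP finQ) (fset_setI finP finQ) cardfsUI.
Qed.

(** * Polynomial identities and the Grothendieck group *)

Lemma HpolyE {R : realType} n (P : set 'rV[R]_n) (t : nat) :
  lattice_polytope P -> (Hpoly P).[t%:R] = (Hcount P t)%:R.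
Proof.
move=> /lattice_polytope_rows[m [V ->]]; move: t; rewrite /Hpoly.
exact: (xgetPex 0 (Hcount_rows_poly (R := R) V)).
Qed.

Lemma poly_eq_nat (p q : {poly rat}) :
  (forall t : nat, p.[t%:R] = q.[t%:R]) -> p = q.
Proof.
move=> pq; apply/eqP; rewrite -subr_eq0; apply/negPn/negP => pq0.
(* These are [size (p - q)] distinct roots, one more than the degree. *)
pose s : seq rat := [seq i%:R | i <- iota 0 (size (p - q))].
have us : uniq s by rewrite map_inj_uniq ?iota_uniq // => i j /eqP; rewrite eqr_nat => /eqP.
have rs : all (root (p - q)) s.
  by apply/allP => _ /mapP[i _ ->]; rewrite rootE hornerD hornerN pq subrr.
by have := max_poly_roots pq0 rs us; rewrite size_map size_iota ltnn.
Qed.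

(** The universal property: the linear extension [g] to the free group kills the relations and
    descends to the quotient. *)
Lemma polytope_group_lift (R : realType) (n : nat) (M : zmodType)
    (f : polytope R n -> M) :
  (forall P Q U I : polytope R n,
     val U = val P `|` val Q -> val I = val P `&` val Q ->
     f U + f I = f P + f Q) ->
  exists F : {additive polytope_group R n -> M},
    forall P, F (polytope_class P) = f P.
Proof.
move=> fval; pose g : {freeg (polytope R n) / int} -> M := fglift (f : polytope R n -> zmodule M).
have gB (x y : {freeg (polytope R n) / int}) : g (x - y) = g x - g y by exact: (lift_is_additive (f : polytope R n -> zmodule M)).
have gD x y : g (x + y) = g x + g y.
  have g0 : g 0 = 0 by rewrite -(subrr (0 : {freeg _ / int})) gB subrr.
  by rewrite -{1}[y]opprK gB -[- y]sub0r gB g0 sub0r opprK.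
have gU P : g << P >> = f P by rewrite /g liftU scale1r.
have ker x : x \in inclexcl_subgroup (n:=n) (R:=R) -> g x = 0.
  (* The generated subgroup lies in every subgroup containing the relations, in particular in the
     kernel of [g]. *)
  rewrite unfold_in => /asboolP/(_ (fun x => g x == 0)) H; apply/eqP; apply: H.
    split=> [|y z]; first by rewrite unfold_in -(subrr (0 : {freeg _ / int})) gB subrr.
    by rewrite !unfold_in gB => /eqP -> /eqP ->; rewrite subrr.
  move=> _ [P [Q [U [I [eU eI ->]]]]]; rewrite unfold_in gB.
  by rewrite !gD !gU (fval P Q) // subrr.
pose F (x : polytope_group R n) : M := g (repr x).
(* Two representatives of a class differ by an element of the subgroup, on which [g] vanishes. *)
have Fpi x : F (\pi_(Quotient.quot (inclexcl_subgroup (n:=n) (R:=R))) x)%qT = g x.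
  apply/eqP; rewrite -subr_eq0 -gB; apply/eqP/ker.
  by rewrite Quotient.idealrBE reprK.
have Fadd : zmod_morphism F.
  move=> x y; rewrite -(reprK x) -(reprK y) -raddfB !Fpi; exact: gB.
pose mF := GRing.isZmodMorphism.Build _ _ F Fadd.
by exists (HB.pack_for {additive polytope_group R n -> M} F mF) => P /=; rewrite Fpi gU.
Qed.

Theorem theorem9 (R : realType) (n : nat) :
  (forall P Q : set 'rV[R]_n,
     lattice_polytope P -> lattice_polytope Q ->
     lattice_polytope (P `|` Q) -> lattice_polytope (P `&` Q) ->
     [/\ forall t : nat,
           (Hcount (P `|` Q) t)%:Z =
             (Hcount P t)%:Z + (Hcount Q t)%:Z - (Hcount (P `&` Q) t)%:Z,
         Hpoly (P `|` Q) = Hpoly P + Hpoly Q - Hpoly (P `&` Q) &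
         SE (P `|` Q) = SE P + SE Q - SE (P `&` Q)])
  /\ (exists Phi : {additive polytope_group R n -> {poly rat}},
        forall P : polytope R n,
          Phi (polytope_class P) = Hpoly (val P) /\
          forall t : nat,
            (Phi (polytope_class P)).[t%:R] = (Hcount (val P) t)%:R)
  /\ (exists Psi : {additive polytope_group R n -> int_series},
        forall P : polytope R n, Psi (polytope_class P) = SE (val P)).
Proof.
have val_count (P Q : set 'rV[R]_n) t :
    lattice_polytope P -> lattice_polytope Q ->
    lattice_polytope (P `|` Q) -> lattice_polytope (P `&` Q) ->
    (Hcount (P `|` Q) t)%:Z =
      (Hcount P t)%:Z + (Hcount Q t)%:Z - (Hcount (P `&` Q) t)%:Z.
  by move=> *; rewrite -PoszD -Hcount_valuation // PoszD addrK.
have val_poly (P Q : set 'rV[R]_n) :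
    lattice_polytope P -> lattice_polytope Q ->
    lattice_polytope (P `|` Q) -> lattice_polytope (P `&` Q) ->
    Hpoly (P `|` Q) = Hpoly P + Hpoly Q - Hpoly (P `&` Q).
  move=> *; apply: poly_eq_nat => t; rewrite hornerD hornerN hornerD !HpolyE //.
  by rewrite -natrD -Hcount_valuation // natrD addrK.
have val_SE (P Q : set 'rV[R]_n) :
    lattice_polytope P -> lattice_polytope Q ->
    lattice_polytope (P `|` Q) -> lattice_polytope (P `&` Q) ->
    SE (P `|` Q) = SE P + SE Q - SE (P `&` Q).
  by move=> *; apply/funext => t; exact: val_count.
have lat (P : polytope R n) : lattice_polytope (val P) by exact: set_valP.
(* Common to both targets: a valuation on polytopes respects the defining relations. *)
have relE (M : zmodType) (f : set 'rV[R]_n -> M) :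
    (forall P Q : set 'rV[R]_n, lattice_polytope P -> lattice_polytope Q ->
      lattice_polytope (P `|` Q) -> lattice_polytope (P `&` Q) ->
      f (P `|` Q) = f P + f Q - f (P `&` Q)) ->
    exists F : {additive polytope_group R n -> M},
      forall P, F (polytope_class P) = f (val P).
  move=> fval; apply: (polytope_group_lift _ _ _ (fun P => f (val P))).
  move=> P Q U I eU eI; have lU := lat U; have lI := lat I; rewrite eU in lU; rewrite eI in lI.
  by rewrite eU eI (fval _ _ (lat P) (lat Q) lU lI) subrK.
split.
  move=> P Q lP lQ lU lI; split; [|exact: val_poly|exact: val_SE].
  by move=> t; exact: val_count.
split; last exact: relE val_SE.
have [Phi PhiE] := relE _ _ val_poly; exists Phi => P; rewrite PhiE; split=> // t.
by rewrite HpolyE.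
Qed.
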